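(* For every $T(n)\in\mathsf{poly}(n)$: every language $\mathcal L\subseteq\{0,1\}^*$ decided by a non-uniform family of Boolean circuits $\{C_n\}$ of depth $O(T(n))$ (and polynomial size) belongs to $\mathsf{Loop}[T(n),\mathrm{size}(C_n),1]$, i.e. for each $n$ there is a deterministic Looped Transformer with embedding size $O(\mathrm{size}(C_n))$ and constant-bit precision whose final output token after $O(T(n))$ loops equals $\mathcal L(x)$ for all $x\in\{0,1\}^n$.
   Context: A Boolean circuit is a DAG over $\{0,1\}$ with $n$ input nodes and a single output node, whose internal nodes (gates) compute AND, OR (unbounded fan-in) or NOT; size = number of nodes, depth = longest input-to-output path. $\mathsf{Loop}[T(n),d(n),s(n)]$ is the set of languages $\mathcal L:\{0,1\}^*\to\{0,1\}$ such that for every $n$ there is a deterministic Looped Transformer $M_n$ with embedding size $O(d(n))$ and $O(s(n))$ bits of precision whose final output token after $O(T(n))$ loop iterations is $\mathcal L(x)$ for all $x\in\{0,1\}^n$. Looped Transformer: embeds the input position-wise, applies a fixed block of constantly many residual non-causal softmax self-attention / ReLU feedforward layers $T$ times, and outputs $\arg\max$ of a linear map of the hidden state at the last position. All arithmetic is finite precision: numbers with a sign bit and $s$-bit mantissa, every operation rounded to nearest representable value, multi-term sums computed left to right with rounding after each addition. *)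

(* Defs.v *)
From Stdlib Require Import Reals.
From mathcomp Require Import ssreflect ssrfun ssrbool eqtype ssrnat seq fintype tuple.

Set Implicit Arguments.
Unset Strict Implicit.
Unset Printing Implicit Defensive.

Definition bigO (f g : nat -> nat) : Prop :=
  exists c : nat, forall n : nat, f n <= c * g n + c.

Definition is_poly (f : nat -> nat) : Prop :=
  exists c k : nat, forall n : nat, f n <= c * n ^ k + c.

(* Nodes are numbered: node p < n is the p-th input, node n + j is the   *)
(* j-th gate.  Gate j may only read nodes < n + j (topological order,    *)
(* hence a DAG).  AND / OR have unbounded fan-in, NOT has fan-in 1.      *)

Inductive gate_kind := GAnd | GOr | GNot.

Record gate := Gate { gkind : gate_kind; gins : seq nat }.

Definition dflt_gate : gate := Gate GAnd [::].

Record circuit (n : nat) := Circuit { cgates : seq gate; cout : nat }.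

Definition wf_circuit (n : nat) (C : circuit n) : Prop :=
  cout C < n + size (cgates C) /\
  forall j : nat, j < size (cgates C) ->
    let g := nth dflt_gate (cgates C) j in
    all (fun p => p < n + j) (gins g) /\ (gkind g = GNot -> size (gins g) = 1).

Definition circuit_size (n : nat) (C : circuit n) : nat := n + size (cgates C).

Definition gate_val (g : gate) (vs : seq bool) : bool :=
  match gkind g with
  | GAnd => all (fun p => nth false vs p) (gins g)
  | GOr  => has (fun p => nth false vs p) (gins g)
  | GNot => ~~ nth false vs (head 0 (gins g))
  end.

Definition node_values (x : seq bool) (gs : seq gate) : seq bool :=
  foldl (fun vs g => rcons vs (gate_val g vs)) x gs.

Definition circuit_eval (n : nat) (C : circuit n) (x : seq bool) : bool :=
  nth false (node_values x (cgates C)) (cout C).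

(* length of the longest path from an input node to each node
   (None if no input node reaches it) *)
Definition gate_depth (g : gate) (ds : seq (option nat)) : option nat :=
  match pmap (fun p => nth None ds p) (gins g) with
  | [::] => None
  | l => Some (foldr maxn 0 l).+1
  end.

Definition node_depths (n : nat) (gs : seq gate) : seq (option nat) :=
  foldl (fun ds g => rcons ds (gate_depth g ds)) (nseq n (Some 0)) gs.

Definition circuit_depth (n : nat) (C : circuit n) : nat :=
  odflt 0 (nth None (node_depths n (cgates C)) (cout C)).

(* Finite-precision arithmetic with a sign bit and an s-bit mantissa:   *)
(*   F_s = { k / 2^s : k in Z, |k| <= 2^s - 1 }.                         *)
(* Rounding to nearest (ties upward), saturating at +-(2^s-1)/2^s.       *)

Definition representable (s : nat) (x : R) : Prop :=
  exists k : Z, x = (IZR k / 2 ^ s)%R /\ (Rabs (IZR k) <= 2 ^ s - 1)%R.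

Definition maxF (s : nat) : R := ((2 ^ s - 1) / 2 ^ s)%R.

Definition rnd (s : nat) (x : R) : R :=
  Rmax (- maxF s) (Rmin (maxF s) (IZR (Int_part (x * 2 ^ s + / 2)) / 2 ^ s)).

Definition fsum (s : nat) (l : seq R) : R :=
  foldl (fun acc a => rnd s (acc + a)%R) 0%R l.

Definition vec (d : nat) := 'I_d -> R.
Definition mat (d : nat) := 'I_d -> 'I_d -> R.

Definition fdot (s d : nat) (u v : vec d) : R :=
  fsum s [seq rnd s (u j * v j)%R | j <- enum 'I_d].

Definition fmatvec (s d : nat) (W : mat d) (v : vec d) : vec d :=
  fun i => fdot s (W i) v.

Definition faddv (s d : nat) (u v : vec d) : vec d :=
  fun i => rnd s (u i + v i)%R.

(* Looped Transformers.  All internal widths are the embedding size d   *)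
(* (smaller widths are obtained by zero padding).                       *)

Inductive layer (d : nat) :=
  | Attn of mat d & mat d & mat d
  | FFN of mat d & vec d & mat d & vec d.

Definition layer_ok (s d : nat) (l : layer d) : Prop :=
  match l with
  | Attn Wq Wk Wv => forall i j, representable s (Wq i j) /\
                       representable s (Wk i j) /\ representable s (Wv i j)
  | FFN W1 b1 W2 b2 => forall i j, representable s (W1 i j) /\
                       representable s (b1 i) /\ representable s (W2 i j) /\
                       representable s (b2 i)
  end.

Definition apply_layer (s n d : nat) (l : layer d) (H : 'I_n -> vec d) : 'I_n -> vec d :=
  match l with
  | Attn Wq Wk Wv =>
      fun i =>
        let q := fmatvec s Wq (H i) in
        let key j := fmatvec s Wk (H j) in
        let val j := fmatvec s Wv (H j) in
        let e j := rnd s (exp (fdot s q (key j))) in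
        let Z := fsum s [seq e j | j <- enum 'I_n] in
        let a j := rnd s (e j / Z)%R in
        let out : vec d := fun c => fsum s [seq rnd s (a j * val j c)%R | j <- enum 'I_n] in
        faddv s (H i) out
  | FFN W1 b1 W2 b2 =>
      fun i =>
        let hid : vec d := fun k => Rmax 0 (rnd s (fmatvec s W1 (H i) k + b1 k)%R) in
        let out := faddv s (fmatvec s W2 hid) b2 in
        faddv s (H i) out
  end.

Record looped_tf (n d : nat) := LoopedTF {
  tf_prec  : nat;
  tf_TE    : bool -> vec d;
  tf_PE    : 'I_n -> vec d;
  tf_block : seq (layer d);
  tf_out0  : vec d;
  tf_out1  : vec d;
  tf_loops : nat
}.

Definition tf_params_ok (n d : nat) (M : looped_tf n d) : Prop :=
  let s := tf_prec M in
  (forall b i, representable s (tf_TE M b i)) /\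
  (forall p i, representable s (tf_PE M p i)) /\
  (forall i, representable s (tf_out0 M i) /\ representable s (tf_out1 M i)) /\
  (forall j, j < size (tf_block M) -> layer_ok s (nth (FFN (fun _ _ => 0%R) (fun _ => 0%R) (fun _ _ => 0%R) (fun _ => 0%R)) (tf_block M) j)).

Definition apply_block (n d : nat) (M : looped_tf n d) (H : 'I_n -> vec d) : 'I_n -> vec d :=
  foldl (fun H' l => apply_layer (tf_prec M) l H') H (tf_block M).

Definition tf_hidden (n d : nat) (M : looped_tf n d) (x : n.-tuple bool) : 'I_n -> vec d :=
  iter (tf_loops M) (apply_block M)
       (fun p => faddv (tf_prec M) (tf_TE M (tnth x p)) (tf_PE M p)).

Definition tf_output (m d : nat) (M : looped_tf m.+1 d) (x : m.+1.-tuple bool) : bool :=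
  let h := tf_hidden M x ord_max in
  let s := tf_prec M in
  if Rlt_dec (fdot s (tf_out0 M) h) (fdot s (tf_out1 M) h) then true else false.

(* L in Loop[T(n), dim(n), prec(n)] (checked on all input lengths n >= 1) *)
Definition in_Loop (L : seq bool -> bool) (T dim prec : nat -> nat) : Prop :=
  exists c : nat, forall m : nat,
    exists (d : nat) (M : looped_tf m.+1 d),
      d <= c * dim m.+1 + c /\
      tf_prec M <= c * prec m.+1 + c /\
      size (tf_block M) <= c /\
      tf_loops M <= c * T m.+1 + c /\
      tf_params_ok M /\
      (forall x : m.+1.-tuple bool, tf_output M x = L x).

(* Main.v *)
Require Import Defs.
From Stdlib Require Import Reals ZArith Lra Lia.
From mathcomp Require Import ssreflect ssrfun ssrbool eqtype ssrnat seq fintype tuple.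
From mathcomp Require Import zify.

(** Take two mantissa bits, so that numbers are k/4 with |k| <= 3. In units of 1/4, the weights 3/4 and
    -3/4 multiply 0 and 1 exactly like 1 and -1, because products are rounded; saturation at 3/4 makes every
    softmax weight equal to 3/4, and a saturating sum of nonpositive terms vanishes only if all its terms do.
    Attention therefore broadcasts the input bits to all positions, and one ReLU unit computes
    a NOR of unbounded fan-in, so that one loop is one synchronous step of a network of NOR nodes.
    A circuit becomes a NOR network by keeping each node in both polarities: one polarity is a NOR of
    literals of the inputs of the gate, the other one its negation, and a node of depth D is stable after
    2D + 2 steps. Nodes without depth, i.e. not reached by any input node, may end arbitrarily long chains of gates;
    as they are constant, their values are wired into the network. *)

Set Implicit Arguments.
Unset Strict Implicit.
Unset Printing Implicit Defensive.

(** * Rounded arithmetic in units of 1/4 *)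

Definition q4 (k : Z) : R := (IZR k / 4)%R.
Definition clip (k : Z) : Z := Z.max (-3) (Z.min 3 k).
(** The product of two numbers of quarters is [a * b / 16]; its nearest multiple of 1/4, ties
    upward, counted in quarters, is the floor of [(a * b + 2) / 4]. *)
Definition mulq (a b : Z) : Z := clip ((a * b + 2) / 4).
Definition zsum : seq Z -> Z := foldl (fun acc a => clip (acc + a)) 0%Z.

Lemma rnd2_sixteenth (m : Z) : rnd 2 (IZR m / 16) = q4 (clip ((m + 2) / 4)).
Proof.
rewrite /rnd.
have -> : Int_part (IZR m / 16 * 2 ^ 2 + / 2) = ((m + 2) / 4)%Z.
  symmetry; apply: Int_part_spec.
  have h := Z.div_mod (m + 2) 4 ltac:(lia).
  have hb := Z.mod_pos_bound (m + 2) 4 ltac:(lia).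
  set k := ((m + 2) / 4)%Z in h *.
  have h1 : (4 * k <= m + 2)%Z by lia.
  have h2 : (m + 2 < 4 * k + 4)%Z by lia.
  move: (IZR_le _ _ h1) (IZR_lt _ _ h2).
  rewrite !plus_IZR !mult_IZR; lra.
move: ((m + 2) / 4)%Z => k; rewrite /maxF /q4 /clip.
have E : ((2 ^ 2 - 1) / 2 ^ 2 = 3 / 4)%R by field.
rewrite E; have -> : (IZR k / 2 ^ 2 = IZR k / 4)%R by field.
have [h|h] := Z_le_gt_dec 3 k.
  have hR := IZR_le _ _ h.
  have -> : Z.max (-3) (Z.min 3 k) = 3%Z by lia.
  by rewrite Rmin_left ?Rmax_right; lra.
have [h'|h'] := Z_le_gt_dec k (-3).
  have hR := IZR_le _ _ h'.
  have -> : Z.max (-3) (Z.min 3 k) = (-3)%Z by lia.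
  by rewrite Rmin_right ?Rmax_left; lra.
have hR := IZR_lt _ _ (Z.gt_lt _ _ h).
have hR' := IZR_lt _ _ (Z.gt_lt _ _ h').
have -> : Z.max (-3) (Z.min 3 k) = k by lia.
by rewrite Rmin_right ?Rmax_right; lra.
Qed.

Lemma rnd2_quarter (k : Z) : rnd 2 (q4 k) = q4 (clip k).
Proof.
have -> : q4 k = (IZR (4 * k) / 16)%R by rewrite /q4 mult_IZR; field.
rewrite rnd2_sixteenth; congr (q4 (clip _)).
by rewrite Z.mul_comm Z.div_add_l // Z.add_0_r.
Qed.

Lemma q4D (a b : Z) : (q4 a + q4 b)%R = q4 (a + b).
Proof. rewrite /q4 plus_IZR; field. Qed.

Lemma rnd2D (a b : Z) : rnd 2 (q4 a + q4 b) = q4 (clip (a + b)).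
Proof. by rewrite q4D rnd2_quarter. Qed.

Lemma rnd2M (a b : Z) : rnd 2 (q4 a * q4 b) = q4 (mulq a b).
Proof.
have -> : (q4 a * q4 b = IZR (a * b) / 16)%R by rewrite /q4 mult_IZR; field.
exact: rnd2_sixteenth.
Qed.

Lemma q40 : q4 0 = 0%R. Proof. rewrite /q4; field. Qed.

Lemma Rmax_q4 (a b : Z) : Rmax (q4 a) (q4 b) = q4 (Z.max a b).
Proof.
rewrite /q4; have [[/IZR_lt h ->]|[/IZR_le h ->]] := Z.max_spec a b.
  by apply: Rmax_right; lra.
by apply: Rmax_left; lra.
Qed.

Lemma representable_q4 (k : Z) : (-3 <= k <= 3)%Z -> representable 2 (q4 k).
Proof.
move=> [h1 h2]; exists k; split; first by rewrite /q4; field.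
by apply: Rabs_le; move: (IZR_le _ _ h1) (IZR_le _ _ h2); lra.
Qed.

Lemma fsum2_q4 (l : seq Z) : fsum 2 (map q4 l) = q4 (zsum l).
Proof.
rewrite /fsum /zsum -q40; elim: l 0%Z => [//|a l IH] acc /=.
by rewrite rnd2D IH.
Qed.

(** * Saturating left-to-right sums *)

Lemma clip_id (k : Z) : (-3 <= k <= 3)%Z -> clip k = k.
Proof. rewrite /clip; lia. Qed.

Lemma clip_bound (k : Z) : (-3 <= clip k <= 3)%Z.
Proof. rewrite /clip; lia. Qed.

Lemma zsum_single (I : eqType) (F : I -> Z) (a : I) (l : seq I) :
  uniq l -> a \in l -> (forall y, y != a -> F y = 0%Z) ->
  zsum (map F l) = clip (F a).
Proof.
move=> U al F0; rewrite /zsum.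
have Z0 : forall s acc, a \notin s -> (-3 <= acc <= 3)%Z ->
    foldl (fun acc a => clip (acc + a)) acc (map F s) = acc.
  elim=> [//|y s IH] acc; rewrite inE negb_or => /andP[ya ys] hacc /=.
  by rewrite F0 1?eq_sym // Z.add_0_r clip_id // IH.
elim: l U al => [//|y l IH] /= /andP[yl U]; rewrite inE => /orP[/eqP e|al].
  by subst y; rewrite Z0 //; apply: clip_bound.
have ya : y != a by apply: contraNneq yl => ->.
by rewrite F0 //= IH.
Qed.

(** Clipped sums depend on the order in general; the bound on the absolute values keeps every
    partial sum in range, whichever of [a] and [b] comes first. *)
Lemma zsum_pair (I : eqType) (F : I -> Z) (a b : I) (l : seq I) :
  uniq l -> a \in l -> b \in l -> a != b ->
  (forall y, y != a -> y != b -> F y = 0%Z) ->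
  (Z.abs (F a) + Z.abs (F b) <= 3)%Z ->
  zsum (map F l) = (F a + F b)%Z.
Proof.
move=> U al bl ab F0 Fab; rewrite /zsum.
pose w (c : I) (s : seq I) := if c \in s then F c else 0%Z.
(* Here [w c s] is what [c] still has to contribute on the remaining list [s]. *)
have Z0 : forall s acc, uniq s -> (Z.abs acc + Z.abs (w a s) + Z.abs (w b s) <= 3)%Z ->
    foldl (fun acc a => clip (acc + a)) acc (map F s) = (acc + w a s + w b s)%Z.
  elim=> [|y s IH] acc; first by rewrite /w /=; lia.
  move=> /= /andP[ys us]; rewrite /w !inE.
  have [e|ya] := eqVneq a y.
    subst y; rewrite [b == a]eq_sym (negbTE ab) /= => h.
    have wa : w a s = 0%Z by rewrite /w (negbTE ys).
    rewrite clip_id; last lia.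
    rewrite IH //; last by rewrite wa /w; lia.
    by rewrite wa /w; lia.
  have [e|yb] := eqVneq b y.
    subst y => /= h.
    have wb : w b s = 0%Z by rewrite /w (negbTE ys).
    rewrite clip_id; last lia.
    rewrite IH //; last by rewrite wb /w; lia.
    by rewrite wb /w; lia.
  move=> /= h; rewrite F0 1?eq_sym // Z.add_0_r clip_id; last lia.
  exact: IH.
by rewrite Z0 /w ?al ?bl //; lia.
Qed.

Lemma zsum_eq0 (I : eqType) (F : I -> Z) (l : seq I) :
  (forall y, F y = 0%Z) -> zsum (map F l) = 0%Z.
Proof. by move=> F0; rewrite /zsum; elim: l => [//|y l IH] /=; rewrite F0 /=. Qed.

(** The accumulator is at most 0 before [a] and negative after it; nonpositive terms and clipping at
    -3 then keep it negative. *)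
Lemma zsum_lt0 (I : eqType) (F : I -> Z) (a : I) (l : seq I) :
  (forall y, (F y <= 0)%Z) -> a \in l -> (F a < 0)%Z -> (zsum (map F l) < 0)%Z.
Proof.
move=> F0 + Fa; rewrite /zsum.
have mono : forall s acc, (acc < 0)%Z ->
    (foldl (fun acc a => clip (acc + a)) acc (map F s) < 0)%Z.
  elim=> [//|y s IH] acc hacc /=; apply: IH; move: (F0 y); rewrite /clip; lia.
suff gen s acc : (acc <= 0)%Z -> a \in s ->
    (foldl (fun acc a => clip (acc + a)) acc (map F s) < 0)%Z by apply: gen; lia.
elim: s acc => [//|y s IH] acc hacc; rewrite inE => /orP[/eqP <-|al] /=.
  by apply: mono; rewrite /clip; lia.
by apply: IH => //; move: (F0 y); rewrite /clip; lia.
Qed.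

Lemma zsum_bound (l : seq Z) : (-3 <= zsum l <= 3)%Z.
Proof.
rewrite /zsum; have: (-3 <= 0 <= 3)%Z by lia.
elim: l 0%Z => [//|a l IH] acc _ /=; apply: IH; exact: clip_bound.
Qed.

(** * Layers over named coordinates *)

Section Coordinates.
Variables (I : finType) (n : nat).
Implicit Types (W : I -> I -> Z) (u v : I -> Z) (h : 'I_n -> I -> Z).

(** Coordinates are named by a finite type [I], so that weights can be defined by matching on their
    role. *)
Definition qvec u : vec #|I| := fun i => q4 (u (enum_val i)).
Definition qmat W : mat #|I| := fun i j => q4 (W (enum_val i) (enum_val j)).

(** Lists [I] in the order in which [fdot] adds, as clipped sums depend on it. *)
Definition coords : seq I := [seq enum_val j | j <- enum 'I_#|I|].
Definition zdot u v : Z := zsum [seq mulq (u x) (v x) | x <- coords].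

Lemma coords_uniq : uniq coords.
Proof. by rewrite map_inj_uniq ?enum_uniq //; apply: enum_val_inj. Qed.

Lemma mem_coords x : x \in coords.
Proof. by rewrite -(enum_rankK x) map_f // mem_enum. Qed.

Lemma fdot_q4 (f g : vec #|I|) u v :
  (forall j, f j = q4 (u (enum_val j))) -> (forall j, g j = q4 (v (enum_val j))) ->
  fdot 2 f g = q4 (zdot u v).
Proof.
move=> fE gE; rewrite /fdot /zdot -fsum2_q4 /coords -!map_comp.
by congr fsum; apply: eq_map => j /=; rewrite fE gE rnd2M.
Qed.

Definition zattn (V : I -> I -> Z) h : 'I_n -> I -> Z := fun p x =>
  clip (h p x + zsum [seq mulq 3 (zdot (V x) (h p')) | p' <- enum 'I_n]).

Definition zffn (W1 : I -> I -> Z) (b1 : I -> Z) (W2 : I -> I -> Z) h : 'I_n -> I -> Z :=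
  fun p x => clip (h p x + zdot (W2 x) (fun k => Z.max 0 (clip (zdot (W1 k) (h p) + b1 k)))).

Definition represents (H : 'I_n -> vec #|I|) h :=
  forall p j, H p j = q4 (h p (enum_val j)).

(* Zero queries give all scores 0, and both [exp 0 = 1] and the normaliser saturate at 3/4,
   so every attention weight is 3/4. *)
Lemma attn_q4 V H h : represents H h ->
  represents (apply_layer 2 (Attn (qmat (fun _ _ => 0%Z)) (qmat (fun _ _ => 0%Z)) (qmat V)) H)
             (zattn V h).
Proof.
move=> HE p j /=.
have one : rnd 2 1 = q4 3.
  have -> : 1%R = q4 4 by rewrite /q4; field.
  by rewrite rnd2_quarter.
have score p' : rnd 2 (exp (fdot 2 (fmatvec 2 (qmat (fun _ _ => 0%Z)) (H p))
     (fmatvec 2 (qmat (fun _ _ => 0%Z)) (H p')))) = q4 3.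
  have z p1 j1 : fmatvec 2 (qmat (fun _ _ => 0%Z)) (H p1) j1 = q4 0.
    rewrite /fmatvec (@fdot_q4 _ _ (fun=> 0%Z) (h p1)) //.
    by rewrite /zdot zsum_eq0.
  rewrite (@fdot_q4 _ _ (fun=> 0%Z) (fun=> 0%Z)) //.
  by rewrite /zdot zsum_eq0 // q40 exp_0.
have Z3 : fsum 2 [seq rnd 2 (exp (fdot 2 (fmatvec 2 (qmat (fun _ _ => 0%Z)) (H p))
     (fmatvec 2 (qmat (fun _ _ => 0%Z)) (H p')))) | p' <- enum 'I_n] = q4 3.
  rewrite (eq_map score) (map_comp q4 (fun=> 3%Z)) fsum2_q4; congr q4.
  (* Position [p] makes the list nonempty: the first term gives 3, and all further ones are absorbed
     by saturation. *)
  case: (enum 'I_n) (mem_enum 'I_n p) => [//|p0 s _]; rewrite /zsum /=.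
  by elim: s => [//|p1 s IH] /=.
rewrite /faddv Z3 HE /zattn -rnd2D -fsum2_q4 -map_comp.
congr (rnd _ (_ + fsum _ _)); apply: eq_map => p' /=.
rewrite score -rnd2M /fmatvec (@fdot_q4 _ _ (V (enum_val j)) (h p')) //.
have -> : (q4 3 / q4 3 = 1)%R by rewrite /q4; field.
by rewrite one.
Qed.

Lemma ffn_q4 W1 b1 W2 H h : represents H h ->
  represents (apply_layer 2 (FFN (qmat W1) (qvec b1) (qmat W2) (qvec (fun=> 0%Z))) H)
             (zffn W1 b1 W2 h).
Proof.
move=> HE p j; rewrite /= /faddv HE /fmatvec.
rewrite (@fdot_q4 _ _ (W2 (enum_val j))
  (fun k => Z.max 0 (clip (zdot (W1 k) (h p) + b1 k)))) //; last first.
  move=> k; rewrite (@fdot_q4 _ _ (W1 (enum_val k)) (h p)) //.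
  by rewrite /qvec rnd2D -q40 Rmax_q4.
by rewrite /qvec rnd2D Z.add_0_r rnd2D (clip_id (zsum_bound _)).
Qed.
End Coordinates.

(** * NOR networks and their simulation by one attention and one ReLU layer *)

Section NorNetwork.
Variables (n : nat) (K : finType) (S : K -> 'I_n + K -> bool).

Definition nor_val (x : 'I_n -> bool) (v : K -> bool) (y : 'I_n + K) : bool :=
  match y with inl i => x i | inr k => v k end.

(** A node without parents is true after one step, which provides constants. *)
Definition nor_step (x : 'I_n -> bool) (v : K -> bool) : K -> bool :=
  fun k => [forall y, S k y ==> ~~ nor_val x v y].

Definition nor_state (x : 'I_n -> bool) (t : nat) : K -> bool :=
  iter t (nor_step x) (fun=> false).

(* [inl (i, true)] is the local copy of input bit i (1 only if the position is i and the bit is set, else 0 or -1),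
   [inl (i, false)] its broadcast copy; [inr (k, true)] holds the value of node k and,
   as a hidden unit, its next value; [inr (k, false)] is the hidden unit that erases the old one. *)
Local Notation I := (('I_n * bool) + (K * bool))%type.

(* The weight 2 units, i.e. 1/2, acts on local copies as the positive part: ties round upward, so 1 goes to 1 and -1 to 0. *)
Definition bcast (x y : I) : Z := (
  match x with
  | inl (i, false) => if y == inl (i, true) then 2 else 0
  | _ => 0
  end)%Z.

Definition parent (k : K) (y : I) : bool :=
  match y with
  | inl (i, false) => S k (inl i)
  | inr (k', true) => S k (inr k')
  | _ => false
  end.

Definition nor_in (x y : I) : Z := (
  match x with
  | inr (k, true) => if parent k y then -3 else 0
  | inr (k, false) => if y == inr (k, true) then 3 else 0
  | _ => 0
  end)%Z.

(** The bias is the value of a NOR whose parents are all 0; any negative sum lowers it to at most 0,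
    which ReLU maps to 0. *)
Definition nor_bias (x : I) : Z := (if x is inr (_, true) then 1 else 0)%Z.

(** The residual connection keeps the old value, so the layer must output the new value minus the
    old one. *)
Definition nor_out (x y : I) : Z := (
  match x with
  | inr (k, true) => if y == inr (k, true) then 3 else if y == inr (k, false) then -3 else 0
  | _ => 0
  end)%Z.

(** Embeddings only add token and position; with the offset -1, [tok] plus [pos] is positive exactly
    for a set bit at its own position. *)
Definition tok (b : bool) (x : I) : Z := (
  match x with inl (_, true) => if b then 0 else -1 | _ => 0 end)%Z.

Definition pos (p : 'I_n) (x : I) : Z := (
  match x with inl (i, true) => if p == i then 1 else 0 | _ => 0 end)%Z.

(** [B] is the range of the broadcast copy of a set bit: it starts at 0 and gains 1 per loop until
    it saturates at 3, so only its positivity after attention is relied upon. *)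
Record simulates (x : 'I_n -> bool) (B : Z -> Prop) (v : K -> bool) (h : 'I_n -> I -> Z) : Prop := Simulates {
  sim_local p i : h p (inl (i, true)) = ((if x p then 0 else -1) + (if p == i then 1 else 0))%Z;
  sim_bcast p i : if x i then B (h p (inl (i, false))) else h p (inl (i, false)) = 0%Z;
  sim_node p k : h p (inr (k, true)) = if v k then 1%Z else 0%Z
}.

(** Only position [i] holds a positive local copy of bit [i], so the sum over positions has at most
    one nonzero term and no cancellation. *)
Lemma simulates_attn x v h : simulates x (fun b => 0 <= b <= 3)%Z v h ->
  simulates x (fun b => 1 <= b <= 3)%Z v (zattn bcast h).
Proof.
case=> hA hB hK.
have zero p (y : I) : (forall z, bcast y z = 0%Z) -> zattn bcast h p y = clip (h p y).
  move=> y0; rewrite /zattn zsum_eq0 ?Z.add_0_r // => p'.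
  by rewrite /zdot zsum_eq0 // => z; rewrite y0.
split=> [p i|p i|p k].
- by rewrite zero // hA; case: (x p); case: (p == i).
- have -> : zattn bcast h p (inl (i, false)) =
      clip (h p (inl (i, false)) + if x i then 1%Z else 0%Z).
    have bc p' : zdot (bcast (inl (i, false))) (h p') = if x p' && (p' == i) then 1%Z else 0%Z.
      rewrite /zdot (@zsum_single _ _ (inl (i, true))) ?coords_uniq ?mem_coords //.
        by rewrite /bcast eqxx hA; case: (x p'); case: (p' == i).
      by move=> y /negbTE yi; rewrite /bcast yi.
    congr (clip (_ + _)).
    rewrite (@zsum_single _ _ i) ?enum_uniq ?mem_enum //.
      by rewrite bc eqxx andbT; case: (x i).
    by move=> p' /negbTE pi; rewrite bc pi andbF.
  by move: (hB p i); case: (x i); rewrite /clip; lia.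
- by rewrite zero // hK; case: (v k).
Qed.

(** Each active parent, of value 1, 2 or 3, still gives a strictly negative term after rounding, and
    all other terms are 0. *)
Lemma nor_unit x v h p k : simulates x (fun b => 1 <= b <= 3)%Z v h ->
  Z.max 0 (clip (zdot (nor_in (inr (k, true))) (h p) + 1)) =
  if nor_step x v k then 1%Z else 0%Z.
Proof.
case=> hA hB hK; rewrite /zdot /nor_step.
have term y : parent k y -> (0 <= h p y <= 3)%Z.
  case: y => [[i []]|[k' []]] //= _; first by move: (hB p i); case: (x i); lia.
  by rewrite hK; case: (v k').
have neg y : parent k y -> (0 < h p y)%Z -> (mulq (-3) (h p y) < 0)%Z.
  move=> /term hy pos_y; rewrite /mulq /clip.
  have : (h p y = 1 \/ h p y = 2 \/ h p y = 3)%Z by lia.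
  by case=> [->|[->|->]].
have nonpos y : (mulq (nor_in (inr (k, true)) y) (h p y) <= 0)%Z.
  rewrite /=; case: ifP => // ky; have [h0|h0] := Z_lt_le_dec 0 (h p y).
    by move: (neg y ky h0); lia.
  by have -> : h p y = 0%Z by move: (term y ky); lia.
case: forallP => [all0|not0].
  rewrite zsum_eq0 // => y /=; case: ifP => // ky.
  suff -> : h p y = 0%Z by [].
  case: y ky => [[i []]|[k' []]] //= Sk.
    by move: (all0 (inl i)) (hB p i); rewrite Sk /=; case: (x i).
  by move: (all0 (inr k')); rewrite Sk hK /=; case: (v k').
have [y] : exists y, ~~ (S k y ==> ~~ nor_val x v y).
  by apply/existsP; rewrite -negb_forall; apply/negP => /forallP.
rewrite negb_imply negbK => /andP[Sk vy].
pose y' : I := match y with inl i => inl (i, false) | inr k' => inr (k', true) end.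
have lt0 : (mulq (nor_in (inr (k, true)) y') (h p y') < 0)%Z.
  have ky : parent k y' by rewrite /y'; case: (y) Sk.
  rewrite /= ky; apply: neg => //; rewrite /y'; case: (y) vy => [i|k'] /= e.
    by move: (hB p i); rewrite e; lia.
  by rewrite hK e.
set z := zsum _; have hz : (z < 0)%Z by apply: (zsum_lt0 nonpos (mem_coords y') lt0).
by rewrite /clip; lia.
Qed.

Lemma simulates_ffn x v h : simulates x (fun b => 1 <= b <= 3)%Z v h ->
  simulates x (fun b => 0 <= b <= 3)%Z (nor_step x v) (zffn nor_in nor_bias nor_out h).
Proof.
move=> sim; have [hA hB hK] := sim.
have zero p (y : I) : (forall z, nor_out y z = 0%Z) ->
    zffn nor_in nor_bias nor_out h p y = clip (h p y).
  by move=> y0; rewrite /zffn /zdot zsum_eq0 ?Z.add_0_r // => z; rewrite y0.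
split=> [p i|p i|p k].
- by rewrite zero // hA; case: (x p); case: (p == i).
- by rewrite zero //; move: (hB p i); case: (x i) => [hb|->] //; rewrite /clip; lia.
- have ne : inr (k, false) != inr (k, true) :> I by apply/eqP => -[].
  have ne' := ne; rewrite eq_sym in ne'.
  (* The second hidden unit of [k] reproduces the old value, to be subtracted. *)
  have copy : Z.max 0 (clip (zdot (nor_in (inr (k, false))) (h p) + 0)) = if v k then 1%Z else 0%Z.
    rewrite /zdot (@zsum_single _ _ (inr (k, true))) ?coords_uniq ?mem_coords //.
      by rewrite /= eqxx hK; case: (v k).
    by move=> y /negbTE yk; rewrite /= yk.
  rewrite /zffn; set hid := (fun k => Z.max _ _).
  have hidT : hid (inr (k, true)) = if nor_step x v k then 1%Z else 0%Z by apply: nor_unit sim.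
  have hidF : hid (inr (k, false)) = if v k then 1%Z else 0%Z by exact: copy.
  rewrite /zdot (@zsum_pair _ _ (inr (k, true)) (inr (k, false)) _ (coords_uniq _) (mem_coords _) (mem_coords _) ne').
  + rewrite /nor_out !eqxx (negbTE ne) hidT hidF hK; case: (v k); case: (nor_step x v k) => //.
  + by move=> y /negbTE y1 /negbTE y2; rewrite /nor_out y1 y2.
  + by rewrite /nor_out !eqxx (negbTE ne) hidT hidF; case: (v k); case: (nor_step x v k).
Qed.

(** * The looped transformer of a NOR network *)

Lemma bcast_bound x y : (-3 <= bcast x y <= 3)%Z.
Proof. by case: x => [[i []]|[k []]] /=; do ?case: ifP. Qed.

Lemma nor_in_bound x y : (-3 <= nor_in x y <= 3)%Z.
Proof. by case: x => [[i []]|[k []]] /=; do ?case: ifP. Qed.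

Lemma nor_out_bound x y : (-3 <= nor_out x y <= 3)%Z.
Proof. by case: x => [[i []]|[k []]] /=; do ?case: ifP. Qed.

(** Token 1 scores 1/4 or 0 according to node [o], since 3/16 rounds to 1/4; token 0 always scores
    0, so the strict comparison reads the bit. *)
Definition nor_tf (o : K) (t : nat) : looped_tf n #|{: I}| := {|
  tf_prec := 2;
  tf_TE := fun b => qvec (tok b);
  tf_PE := fun p => qvec (pos p);
  tf_block := [:: Attn (qmat (fun _ _ => 0%Z)) (qmat (fun _ _ => 0%Z)) (qmat bcast);
                  FFN (qmat nor_in) (qvec nor_bias) (qmat nor_out) (qvec (fun=> 0%Z))];
  tf_out0 := qvec (fun=> 0%Z);
  tf_out1 := qvec (fun x => if x == inr (o, true) then 3%Z else 0%Z);
  tf_loops := t |}.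

Lemma nor_tf_params_ok o t : tf_params_ok (nor_tf o t).
Proof.
have ok0 : representable 2 (q4 0) by apply: representable_q4; lia.
split; first by move=> b i; apply: representable_q4; rewrite /tok; case: (enum_val i) => [[? []]|[? []]] //; case: b.
split; first by move=> p i; apply: representable_q4; rewrite /pos; case: (enum_val i) => [[? []]|[? []]] //; case: ifP.
split; first by move=> i; split; apply: representable_q4 => //; case: ifP.
case=> [|[|//]] _ /= i j; rewrite /qmat /qvec.
  by do ![split] => //; apply: representable_q4; apply: bcast_bound.
do ![split] => //; apply: representable_q4; rewrite ?nor_in_bound ?nor_out_bound //.
- exact: nor_in_bound.
- by rewrite /nor_bias; case: (enum_val i) => [[? []]|[? []]].
- exact: nor_out_bound.
Qed.

Lemma nor_tf_hidden o t (x : n.-tuple bool) :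
  exists2 h, represents (tf_hidden (nor_tf o t) x) h
    & simulates (tnth x) (fun b => 0 <= b <= 3)%Z (nor_state (tnth x) t) h.
Proof.
rewrite /tf_hidden /nor_state /=; elim: t => [|t [h hr hs]] /=.
  exists (fun p y => clip (tok (tnth x p) y + pos p y)).
    by move=> p j; rewrite /faddv rnd2D.
  by split=> [p i|p i|p k] //=; case: (tnth x _) => //; case: ifP.
exists (zffn nor_in nor_bias nor_out (zattn bcast h)); last exact/simulates_ffn/simulates_attn.
exact/ffn_q4/attn_q4.
Qed.

Lemma card_nor_tf : #|{: I}| = n * 2 + #|K| * 2.
Proof. by rewrite card_sum !card_prod card_ord card_bool. Qed.
End NorNetwork.

Lemma nor_tf_output m (K : finType) (S : K -> 'I_m.+1 + K -> bool) o t (x : m.+1.-tuple bool) :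
  tf_output (nor_tf S o t) x = nor_state S (tnth x) t o.
Proof.
rewrite /tf_output; have [h hr [_ _ hK]] := nor_tf_hidden S o t x.
rewrite (@fdot_q4 _ _ _ (fun=> 0%Z) (h ord_max)) //
  (@fdot_q4 _ _ _ (fun x => if x == inr (o, true) then 3%Z else 0%Z) (h ord_max)) //.
rewrite /zdot zsum_eq0 // (@zsum_single _ _ (inr (o, true))) ?coords_uniq ?mem_coords //; last first.
  by move=> y /negbTE ->.
rewrite eqxx hK; case: (nor_state _ _ _ _).
  have -> : clip (mulq 3 1) = 1%Z by [].
  by case: Rlt_dec => // -[]; rewrite /q4; lra.
have -> : clip (mulq 3 0) = 0%Z by [].
by case: Rlt_dec => // h0; case: (Rlt_irrefl _ h0).
Qed.

(** * Lists built by successive evaluation *)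

Section FoldRcons.
Variables (A B : Type) (d : B) (e : A) (f : A -> seq B -> B) (init : seq B).
Let run gs := foldl (fun vs g => rcons vs (f g vs)) init gs.

Lemma size_fold_rcons gs : size (run gs) = size init + size gs.
Proof.
rewrite /run; elim/last_ind: gs => [|gs g IH]; first by rewrite addn0.
by rewrite foldl_rcons !size_rcons IH addnS.
Qed.

Lemma nth_fold_rcons_init gs p : p < size init -> nth d (run gs) p = nth d init p.
Proof.
move=> hp; elim/last_ind: gs => [//|gs g IH].
rewrite /run foldl_rcons nth_rcons -/(run gs) size_fold_rcons.
by rewrite (leq_trans hp (leq_addr _ _)).
Qed.

(** [us] is the list as step [j] saw it; later steps only append, so it can be replaced by the final
    list below its length. *)
Lemma nth_fold_rcons gs j : j < size gs ->
  exists2 us, (forall q, q < size init + j -> nth d us q = nth d (run gs) q)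
    & nth d (run gs) (size init + j) = f (nth e gs j) us.
Proof.
elim/last_ind: gs => [//|gs g IH].
rewrite size_rcons ltnS leq_eqVlt nth_rcons {2}/run foldl_rcons -/(run gs).
move=> /orP[/eqP->|hj].
  rewrite ltnn eqxx nth_rcons size_fold_rcons ltnn eqxx; exists (run gs) => // q hq.
  by rewrite /run foldl_rcons nth_rcons -/(run gs) size_fold_rcons hq.
rewrite hj nth_rcons size_fold_rcons ltn_add2l hj; have [us h1 h2] := IH hj.
exists us => // q hq; rewrite h1 // /run foldl_rcons nth_rcons -/(run gs) size_fold_rcons.
by rewrite (leq_trans hq) // leq_add2l ltnW.
Qed.
End FoldRcons.

(** * Values and depths of circuit nodes *)

Section CircuitToNor.
Variables (n : nat) (C : circuit n).
Hypothesis wf : wf_circuit C.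

Local Notation N := (circuit_size C).

Definition nval (x : seq bool) (p : nat) : bool := nth false (node_values x (cgates C)) p.
Definition ndep (p : nat) : option nat := nth None (node_depths n (cgates C)) p.
Definition gate_at (p : nat) : gate := nth dflt_gate (cgates C) (p - n).

Lemma nval_input x p : size x = n -> p < n -> nval x p = nth false x p.
Proof. by move=> sx pn; rewrite /nval /node_values nth_fold_rcons_init ?sx. Qed.

Lemma ndep_input p : p < n -> ndep p = Some 0.
Proof.
move=> pn; rewrite /ndep /node_depths nth_fold_rcons_init ?size_nseq //.
by rewrite nth_nseq pn.
Qed.

Lemma gins_lt p q : n <= p < N -> q \in gins (gate_at p) -> q < p.
Proof.
move=> /andP[np pN]; have hj : p - n < size (cgates C) by rewrite /circuit_size in pN; lia.
have [/allP all_lt _] := wf.2 _ hj.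
by move=> /all_lt; rewrite subnKC.
Qed.

Lemma gins_not p : n <= p < N -> gkind (gate_at p) = GNot ->
  gins (gate_at p) = [:: head 0 (gins (gate_at p))].
Proof.
move=> /andP[np pN]; have hj : p - n < size (cgates C) by rewrite /circuit_size in pN; lia.
have [_ h] := wf.2 _ hj; move/h; rewrite -/(gate_at p).
by case: (gins _) => [|q []].
Qed.

Lemma nval_gate x p : size x = n -> n <= p < N ->
  nval x p = match gkind (gate_at p) with
             | GAnd => all (nval x) (gins (gate_at p))
             | GOr => has (nval x) (gins (gate_at p))
             | GNot => ~~ nval x (head 0 (gins (gate_at p)))
             end.
Proof.
move=> sx pN; have [np pN'] := andP pN.
have hj : p - n < size (cgates C) by rewrite /circuit_size in pN'; lia.
have := nth_fold_rcons false dflt_gate gate_val x hj.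
rewrite sx subnKC // => -[us usE]; rewrite -/(node_values x (cgates C)) -/(nval x p) => ->.
have usg q : q \in gins (gate_at p) -> nth false us q = nval x q by move/(gins_lt pN)/usE.
rewrite /gate_val -/(gate_at p); case E: (gkind _).
- exact: eq_in_all.
- exact: eq_in_has.
- by rewrite usg // (gins_not pN E) mem_head.
Qed.

Lemma ndep_gate p : n <= p < N ->
  ndep p = match pmap ndep (gins (gate_at p)) with
           | [::] => None
           | l => Some (foldr maxn 0 l).+1
           end.
Proof.
move=> pN; have [np pN'] := andP pN.
have hj : p - n < size (cgates C) by rewrite /circuit_size in pN'; lia.
have := nth_fold_rcons None dflt_gate gate_depth (nseq n (Some 0)) hj.
rewrite size_nseq subnKC // => -[us usE]; rewrite -/(node_depths n (cgates C)) -/(ndep p) => ->.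
rewrite /gate_depth -/(gate_at p).
have -> // : pmap (fun q => nth None us q) (gins (gate_at p)) = pmap ndep (gins (gate_at p)).
have : forall q, q \in gins (gate_at p) -> nth None us q = ndep q by move=> q /(gins_lt pN)/usE.
elim: (gins _) => [//|q s IH] h /=; rewrite h ?mem_head // IH // => r rs.
by apply: h; rewrite inE rs orbT.
Qed.

Lemma ndep_gate_none p q : n <= p < N -> ndep p = None ->
  q \in gins (gate_at p) -> ndep q = None.
Proof.
move=> pN; rewrite (ndep_gate pN); case E: (pmap _ _) => [|//] _ qg.
case Q: (ndep q) => [D|//].
have : D \in pmap ndep (gins (gate_at p)) by rewrite mem_pmap -Q map_f.
by rewrite E.
Qed.

Lemma ndep_gate_some p D q : n <= p < N -> ndep p = Some D ->
  q \in gins (gate_at p) -> odflt 0 (ndep q) < D.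
Proof.
move=> pN; rewrite (ndep_gate pN) => + qg.
(* An input without depth counts as 0, which is below [D] because [D] is a successor. *)
case Q: (ndep q) => [D'|] /=; last by case: (pmap _ _) => [//|? ?] [<-].
have : D' \in pmap ndep (gins (gate_at p)) by rewrite mem_pmap -Q map_f.
case: (pmap _ _) => [//|a l] + [<-]; rewrite ltnS -/(foldr maxn 0 (a :: l)).
elim: (a :: l) => [//|b s IH]; rewrite inE => /orP[/eqP->|/IH] /=; first exact: leq_maxl.
by move/leq_trans; apply; apply: leq_maxr.
Qed.

(** Input nodes have depth 0 and the inputs of a depthless gate are depthless, so the recursion
    never reaches [x]. *)
Lemma nval_const x x' p : size x = n -> size x' = n -> p < N -> ndep p = None ->
  nval x p = nval x' p.
Proof.
move=> sx sx'; elim/ltn_ind: p => p IH pN dp.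
have np : n <= p by case: leqP => // /ndep_input; rewrite dp.
have pN2 : n <= p < N by rewrite np.
have ins q : q \in gins (gate_at p) -> nval x q = nval x' q.
  move=> qg; have qp := gins_lt pN2 qg.
  by apply: IH => //; [apply: ltn_trans pN | apply: ndep_gate_none qg].
rewrite (nval_gate sx pN2) (nval_gate sx' pN2); case E: (gkind _); [exact: eq_in_all | exact: eq_in_has |].
by rewrite ins // (gins_not pN2 E) mem_head.
Qed.

(** * The NOR network of a circuit and its stabilization time *)

Local Notation K := ('I_N * bool)%type.

(* Node [(p, b)] of the NOR network is to hold the bit "circuit node p has value b".
   [rail p] is the polarity computed from the inputs of p; the other one is its negation. *)
Definition rail (p : nat) : bool :=
  if p < n then false
  else if ndep p is None then nval (nseq n false) p
  else if gkind (gate_at p) is GOr then false else true.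

(** By De Morgan, AND is a NOR of negated inputs; NOT and the negation of OR are NORs of plain
    inputs. *)
Definition lit (p : nat) : bool := if gkind (gate_at p) is GAnd then false else true.

(** A depthless node has no parents on its rail: the empty NOR is true, and [rail] is by choice its
    constant value. *)
Definition nor_of_circuit (k : K) (y : 'I_n + K) : bool :=
  let p := k.1 in
  if k.2 != rail p then y == inr (p, rail p)
  else if p < n then (if y is inl i then i == p :> nat else false)
  else if ndep p is None then false
  else if y is inr (q, c) then (val q \in gins (gate_at p)) && (c == lit p) else false.

(** An input of a gate of depth D has depth at most D - 1, so both its polarities are stable at time
    2D, and the rail one step later. *)
Lemma nor_state_rail (x : n.-tuple bool) t (p : 'I_N) :
  (forall q : 'I_N, q < p -> forall b, (odflt 0 (ndep q)).*2 + 2 <= t ->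
     nor_state nor_of_circuit (tnth x) t (q, b) = (nval x q == b)) ->
  (odflt 0 (ndep p)).*2 + 1 <= t.+1 ->
  nor_state nor_of_circuit (tnth x) t.+1 (p, rail p) = (nval x p == rail p).
Proof.
move=> IH ht; have pN := ltn_ord p; have sx := size_tuple x.
rewrite /nor_state iterS -/(nor_state _ _ t) /nor_step /nor_of_circuit /= eqxx /=.
have [pn|np] := ltnP p n.
  have -> : rail p = false by rewrite /rail pn.
  rewrite nval_input // -[nth _ _ _](tnth_nth _ x (Ordinal pn)).
  apply/forallP/idP => [/(_ (inl (Ordinal pn)))|h [i|//]] /=.
    by rewrite eqxx /= => /negbTE ->.
  by apply/implyP => /eqP ip; have -> : i = Ordinal pn by [apply: val_inj]; case: (tnth _ _) h.
have pN2 : n <= p < N by rewrite np.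
case D: (ndep p) => [d|]; last first.
  have -> : rail p = nval x p.
    by rewrite /rail ltnNge np D /=; apply: nval_const; rewrite ?size_nseq.
  by rewrite eqxx; apply/forallP.
have inp (q : 'I_N) : val q \in gins (gate_at p) ->
    nor_state nor_of_circuit (tnth x) t (q, lit p) = (nval x q == lit p).
  move=> qg; apply: IH; first exact: gins_lt qg.
  by move: (ndep_gate_some pN2 D qg) ht; rewrite D /=; lia.
have -> : [forall y : 'I_n + K,
     (if y is inr (q, c) then (val q \in gins (gate_at p)) && (c == lit p) else false) ==>
     ~~ nor_val (tnth x) (nor_state nor_of_circuit (tnth x) t) y] =
   all (fun q => nval x q != lit p) (gins (gate_at p)).
  apply/forallP/allP => [h q qg|h [i|[q c]]] //=.
    have qN : q < N by apply: ltn_trans (gins_lt pN2 qg) pN.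
    have := h (inr (Ordinal qN, lit p)).
    by rewrite /= qg eqxx /= (inp (Ordinal qN)).
  by apply/implyP => /andP[qg /eqP ->]; rewrite inp // h.
rewrite (nval_gate sx pN2) /rail ltnNge np D /= /lit; case E: (gkind _).
- by rewrite eqb_id; apply: eq_all => q; case: (nval x q).
- by rewrite eqbF_neg -all_predC; apply: eq_all => q; rewrite /= eqb_id.
- by rewrite (gins_not pN2 E) /= andbT; case: (nval x _).
Qed.

Lemma nor_state_circuit (x : n.-tuple bool) t (p : 'I_N) b :
  (odflt 0 (ndep p)).*2 + 2 <= t ->
  nor_state nor_of_circuit (tnth x) t (p, b) = (nval x p == b).
Proof.
(* Induction on the node number rather than the depth, for all [t], since the rail at one time needs
   the inputs at the preceding time. *)
move: t b; have [m] := ubnP (val p); elim: m p => // m IH p; rewrite ltnS => pm t b ht.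
have prim t' : (odflt 0 (ndep p)).*2 + 1 <= t' ->
    nor_state nor_of_circuit (tnth x) t' (p, rail p) = (nval x p == rail p).
  case: t' => [|t'] ht'; first by lia.
  by apply: nor_state_rail => // q qp c; apply: IH; apply: leq_trans pm.
have [->|nb] := eqVneq b (rail p); first by apply: prim; lia.
case: t ht => [|t] ht; first by lia.
rewrite /nor_state iterS -/(nor_state _ _ t) /nor_step /nor_of_circuit /= nb /=.
have -> : (nval x p == b) = ~~ (nval x p == rail p).
  by case: (nval x p) nb; case: b; case: (rail p).
rewrite -(prim t); last by lia.
apply/forallP/idP => [/(_ (inr (p, rail p)))|h y]; first by rewrite eqxx.
by apply/implyP => /eqP ->.
Qed.
End CircuitToNor.

(** * Choice of dimension and number of loops *)

Theorem mainTheorem2 (T : nat -> nat) (L : seq bool -> bool)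
    (C : forall n : nat, circuit n) :
  is_poly T ->
  (forall n : nat, wf_circuit (C n)) ->
  (forall (n : nat) (x : n.-tuple bool), circuit_eval (C n) x = L x) ->
  bigO (fun n => circuit_depth (C n)) T ->
  is_poly (fun n => circuit_size (C n)) ->
  in_Loop L T (fun n => circuit_size (C n)) (fun _ => 1).
Proof.
move=> _ wf evalC [c0 depC] _.
(* With N the circuit size the dimension is 2n + 4N, at most 6N; the loops number at most 2 ([c0] T
   + [c0]) + 2. *)
exists (c0.*2 + 6) => m; pose n := m.+1; pose o := (Ordinal (wf n).1, true).
pose t := (circuit_depth (C n)).*2 + 2.
exists _, (nor_tf (@nor_of_circuit n (C n)) o t); split.
  rewrite card_nor_tf card_prod card_ord card_bool /circuit_size -/n; nia.
split; first by rewrite /=; lia.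
split; first by rewrite /=; lia.
split; first by rewrite /= /t; move: (depC n); rewrite -/n; nia.
split; first exact: nor_tf_params_ok.
move=> x; rewrite nor_tf_output nor_state_circuit ?eqb_id; last by [].
  by rewrite -evalC.
exact: wf.
Qed.
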